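(* Let $\varrho=((\rho_t^x)_{t\in\mathbb{N}_0})_{x\in E}$ be a family of dynamic conditional risk mappings such that $(\rho^x)_{x\in E}$ is regular. Then $\varrho$ satisfies the Markov property if and only if for each $x\in E$ and $t\in\mathbb{N}_0$ the map $\rho_t^x$ sends $b\mathcal{F}_{t,\infty}$ into $b\mathcal{F}_{t,t}$ (up to $\mathbb{P}^x$-a.s. equality) and, for each $x\in E$, $t\in\mathbb{N}_0$ and $Z\in b\mathcal{F}$, $$Z\circ\theta_t\in\mathcal{A}_t^x\iff Z\in\tilde{\mathcal{A}}_t^x.$$
   Context: Setting. $E$ is a Polish space with Borel $\sigma$-algebra $\mathcal{E}$; $\mathbb{N}_0=\{0,1,2,\ldots\}$; $\Omega=E^{\mathbb{N}_0}$; $X_t(\omega)=\omega(t)$ is the coordinate process; $\mathcal{F}_t=\sigma(X_s: s\le t)$ and $\mathcal{F}=\sigma(\bigcup_t\mathcal{F}_t)$; $\mathcal{F}_{t,\infty}=\sigma(X_s:s\ge t)$ and $\mathcal{F}_{t,t}=\sigma(X_t)$. $X$ is a time-homogeneous Markov chain; $x\mapsto\mathbb{P}^x$ is a measurable map from $E$ to the probability measures on $(\Omega,\mathcal{F})$, where $\mathbb{P}^x$ is the law of the chain started at $x$ (so $\mathbb{P}^x(X_0=x)=1$). The shifts $\theta_t:\Omega\to\Omega$ satisfy $X_s\circ\theta_t=X_{t+s}$. $b\mathcal{G}$ denotes the bounded $\mathcal{G}$-measurable real random variables. Risk mapping on $(\Omega,\mathcal{F},\mathbb{P}^x)$: a function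 $\rho^x:b\mathcal{F}\to\mathbb{R}$ with $\rho^x(0)=0$; $\rho^x(Z+c)=c+\rho^x(Z)$ for $Z\in b\mathcal{F}$, $c\in\mathbb{R}$; and $Z\le Z'$ $\mathbb{P}^x$-a.s. implies $\rho^x(Z)\le\rho^x(Z')$. Conditional risk mapping on $(\Omega,\mathcal{F},\mathbb{P}^x)$ with respect to $\mathcal{F}_t$: a function $\rho^x_t:b\mathcal{F}\to b\mathcal{F}_t$ with $\rho_t^x(0)=0$ $\mathbb{P}^x$-a.s.; $\rho_t^x(Z+Z')=Z'+\rho_t^x(Z)$ $\mathbb{P}^x$-a.s. for $Z\in b\mathcal{F}$, $Z'\in b\mathcal{F}_t$; and $Z\le Z'$ $\mathbb{P}^x$-a.s. implies $\rho_t^x(Z)\le\rho_t^x(Z')$ $\mathbb{P}^x$-a.s. Dynamic conditional risk mapping on $(\Omega,\mathcal{F},(\mathcal{F}_t),\mathbb{P}^x)$: a sequence $(\rho_t^x)_{t\in\mathbb{N}_0}$ where $\rho_0^x$ is a risk mapping and, for $t\ge1$, $\rho_t^x$ is a conditional risk mapping with respect to $\mathcal{F}_t$ (both on $(\Omega,\mathcal{F},\mathbb{P}^x)$). A family of dynamic conditional risk mappings consists of one such sequence for each $x\in E$. Write $\rho^x:=\rho_0^x$. Regularity: a collection $(\rho^x)_{x\in E}$ of risk mappings is regular if for all $Z\in b\mathcal{F}$ the map $x\mapsto\rho^x(Z)$ is bounded and measurable. Markov property: $\varrho=((\rho_t^x)_{t\in\mathbb{N}_0})_{x\in E}$ satisfies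 the Markov property (is Markov) if $(\rho^x_0)_{x\in E}$ is regular and for each $x\in E$, $Z\in b\mathcal{F}$, $t\in\mathbb{N}_0$: $\rho_t^x(Z\circ\theta_t)=\rho^{X_t}(Z)$ $\mathbb{P}^x$-a.s., where $\rho^{X_t}(Z)$ is the random variable $\omega\mapsto\rho^{X_t(\omega)}(Z)$. Acceptance sets: $\mathcal{A}_t^x=\{Y\in b\mathcal{F}:\rho_t^x(Y)\le0\ \mathbb{P}^x\text{-a.s.}\}$ and $\tilde{\mathcal{A}}_t^x=\{Y\in b\mathcal{F}:\rho^{X_t}(Y)\le0\ \mathbb{P}^x\text{-a.s.}\}$. *)

(* Defs.v *)
From HB Require Import structures.
From mathcomp Require Import all_boot all_order all_algebra.
From mathcomp Require Import all_classical all_reals all_analysis.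

Set Implicit Arguments.
Unset Strict Implicit.
Unset Printing Implicit Defensive.

Import Order.TTheory GRing.Theory Num.Theory.
Import numFieldNormedType.Exports.

Local Open Scope classical_set_scope.
Local Open Scope ring_scope.

(* Separable and completely metrizable; the complete metric [d] is a witness
   for the topology of [T], not part of its structure. *)
Definition polish (R : realType) (T : topologicalType) : Prop :=
  (exists2 S : set T, countable S & dense S) /\
  exists d : T -> T -> R,
    [/\ forall x y, (d x y = 0) <-> (x = y),
        forall x y, d x y = d y x,
        forall x y z, d x z <= d x y + d y z,
        forall (x : T) (A : set T),
          nbhs x A <-> exists2 e : R, 0 < e & [set y | d x y < e] `<=` A
      & forall u : nat -> T,
          (forall e : R, 0 < e -> exists N : nat, forall m n : nat,
             (N <= m)%N -> (N <= n)%N -> d (u m) (u n) < e) ->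
          exists l : T, u @ \oo --> l].

Notation borelType E := (g_sigma_algebraType (@open E)).

Definition coord_process (E : Type) (t : nat) (w : nat -> E) : E := w t.

Definition time_shift (E : Type) (t : nat) (w : nat -> E) : nat -> E :=
  fun s => w (t + s)%N.

Definition sigma_coord (E : ptopologicalType) (I : set nat) :
    set (set (nat -> E)) :=
  <<s \bigcup_(s in I)
        preimage_set_system setT (coord_process s : (nat -> E) -> borelType E)
          measurable >>.

Definition past (E : ptopologicalType) (t : nat) : set (set (nat -> E)) :=
  sigma_coord [set s | (s <= t)%N].

Definition future (E : ptopologicalType) (t : nat) : set (set (nat -> E)) :=
  sigma_coord [set s | (t <= s)%N].

Definition present (E : ptopologicalType) (t : nat) : set (set (nat -> E)) :=
  sigma_coord [set t].

Arguments past : clear implicits.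
Arguments future : clear implicits.
Arguments present : clear implicits.

Definition all_time (E : ptopologicalType) : set (set (nat -> E)) :=
  <<s \bigcup_(t in [set: nat]) past E t >>.

Arguments all_time : clear implicits.

Notation pathType E := (g_sigma_algebraType (all_time E)).

(* Bounded functions measurable for the sigma-algebra generated by [G]; when [G]
   is already a sigma-algebra this is G-measurability. *)
Definition bmeas (R : realType) (T : pointedType) (G : set (set T)) :
    set (T -> R) :=
  [set f | measurable_fun [set: g_sigma_algebraType G]
             (f : g_sigma_algebraType G -> R) /\
           bounded_fun f].

(* The integral identity says that q(X_t, B) is a version of the conditional
   probability of {X_{t+1} in B} given F_t under P^x; the transition kernel [q]
   depends neither on the time nor on the starting point. *)
Definition homogeneous_markov_chain (R : realType) (E : ptopologicalType)
    (P : borelType E -> pprobability (pathType E) R) : Prop :=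
  (forall x : E, P x (coord_process 0 @^-1` [set x]) = 1%E) /\
  exists q : R.-pker (borelType E) ~> (borelType E),
    forall (x : E) (t : nat) (A : set (nat -> E)) (B : set E),
      past E t A -> measurable (B : set (borelType E)) ->
      P x (A `&` coord_process t.+1 @^-1` B) =
        (\int[P x]_(w in (A : set (pathType E))) q (coord_process t w) B)%E.

(* Risk mappings are total on real functions on the path space; only their values
   on bounded measurable functions are constrained or used. *)
Definition risk_mapping (R : realType) (E : ptopologicalType)
    (Q : probability (pathType E) R) (rho : ((nat -> E) -> R) -> R) : Prop :=
  [/\ rho (cst 0) = 0,
      forall (Z : (nat -> E) -> R) (c : R), bmeas (all_time E) Z ->
        rho (Z \+ cst c) = c + rho Z
    & forall Z Z' : (nat -> E) -> R,
        bmeas (all_time E) Z -> bmeas (all_time E) Z' ->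
        {ae Q, forall w, Z w <= Z' w} -> rho Z <= rho Z'].

Definition cond_risk_mapping (R : realType) (E : ptopologicalType)
    (Q : probability (pathType E) R) (t : nat)
    (rho : ((nat -> E) -> R) -> (nat -> E) -> R) : Prop :=
  [/\ forall Z : (nat -> E) -> R,
        bmeas (all_time E) Z -> bmeas (past E t) (rho Z),
      {ae Q, forall w, rho (cst 0) w = 0},
      forall Z Z' : (nat -> E) -> R,
        bmeas (all_time E) Z -> bmeas (past E t) Z' ->
        {ae Q, forall w, rho (Z \+ Z') w = Z' w + rho Z w}
    & forall Z Z' : (nat -> E) -> R,
        bmeas (all_time E) Z -> bmeas (all_time E) Z' ->
        {ae Q, forall w, Z w <= Z' w} ->
        {ae Q, forall w, rho Z w <= rho Z' w}].

(* [riskS t] is the conditional risk mapping at time t + 1. *)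
Record dynamic_risk_mapping (R : realType) (E : ptopologicalType)
    (Q : probability (pathType E) R) := DynamicRiskMapping {
  risk0 : ((nat -> E) -> R) -> R ;
  riskS : nat -> ((nat -> E) -> R) -> (nat -> E) -> R ;
  risk0P : risk_mapping Q risk0 ;
  riskSP : forall t : nat, cond_risk_mapping Q t.+1 (riskS t) }.

(* rho_t as a random variable for every t >= 0, a real number being identified
   with the constant random variable at t = 0. *)
Definition risk_at (R : realType) (E : ptopologicalType)
    (Q : probability (pathType E) R) (rho : dynamic_risk_mapping Q)
    (t : nat) (Z : (nat -> E) -> R) : (nat -> E) -> R :=
  if t is t'.+1 then riskS rho t' Z else cst (risk0 rho Z).

Definition regular (R : realType) (E : ptopologicalType)
    (rho0 : E -> ((nat -> E) -> R) -> R) : Prop :=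
  forall Z : (nat -> E) -> R, bmeas (all_time E) Z ->
    bmeas (@open E) (fun x : E => rho0 x Z).

Definition markov_risk (R : realType) (E : ptopologicalType)
    (P : borelType E -> pprobability (pathType E) R)
    (rho : forall x : E, dynamic_risk_mapping (P x)) : Prop :=
  regular (fun x : E => risk0 (rho x)) /\
  forall (x : E) (Z : (nat -> E) -> R) (t : nat), bmeas (all_time E) Z ->
    {ae P x, forall w : nat -> E,
       risk_at (rho x) t (Z \o time_shift t) w = risk0 (rho (coord_process t w)) Z}.

Definition acceptance (R : realType) (E : ptopologicalType)
    (P : borelType E -> pprobability (pathType E) R)
    (rho : forall x : E, dynamic_risk_mapping (P x)) (x : E) (t : nat) :
    set ((nat -> E) -> R) :=
  [set Y | bmeas (all_time E) Y /\
           {ae P x, forall w : nat -> E, risk_at (rho x) t Y w <= 0}].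

Definition acceptance_tilde (R : realType) (E : ptopologicalType)
    (P : borelType E -> pprobability (pathType E) R)
    (rho : forall x : E, dynamic_risk_mapping (P x)) (x : E) (t : nat) :
    set ((nat -> E) -> R) :=
  [set Y | bmeas (all_time E) Y /\
           {ae P x, forall w : nat -> E, risk0 (rho (coord_process t w)) Y <= 0}].

(* Main.v *)
(* Since Z |-> Z o theta_t identifies bF with bF_{t,infty}, the first condition
   provides a Borel f with rho_t(Z o theta_t) = f(X_t) a.s.; put
   g(y) = rho^y(Z).  For bounded Borel h, apply the acceptance equivalence to
   Z - h(X_0): translation invariance (together with X_0 = y P^y-a.s.) turns it
   into "f(X_t) <= h(X_t) a.s. iff g(X_t) <= h(X_t) a.s.", and h = f, h = g give
   f(X_t) = g(X_t) a.s. *)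

Require Import Defs.
From HB Require Import structures.
From mathcomp Require Import all_boot all_order all_algebra.
From mathcomp Require Import all_classical all_reals all_analysis.

Set Implicit Arguments.
Unset Strict Implicit.
Unset Printing Implicit Defensive.

Import Order.TTheory GRing.Theory Num.Theory.
Import numFieldNormedType.Exports.
Local Open Scope classical_set_scope.
Local Open Scope ring_scope.

(** * Bounded measurable functions and composition *)

Lemma gen_sigma_preimage (S T : Type) (G : set (set T)) (G' : set (set S))
    (u : S -> T) :
  (forall A, G A -> <<s G' >> (u @^-1` A)) ->
  forall A, <<s G >> A -> <<s G' >> (u @^-1` A).
Proof.
(* Good-sets argument: the sets whose preimage under [u] lies in [<<s G' >>] form a sigma-algebra
   containing [G]. *)
move=> uG A; have := @smallest_sub _ (@sigma_algebra T setT) G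
  (image_set_system setT u <<s G' >>).
rewrite /image_set_system /=; under eq_fun do rewrite setTI.
apply => //.
have := sigma_algebra_image u (smallest_sigma_algebra setT G').
by rewrite /image_set_system /=; under eq_fun do rewrite setTI.
Qed.

Lemma bmeas_comp (R : realType) (S T : pointedType) (G : set (set T))
    (G' : set (set S)) (u : S -> T) (f : T -> R) :
  (forall A, G A -> <<s G' >> (u @^-1` A)) ->
  bmeas G f -> bmeas G' (f \o u).
Proof.
move=> uG [mf bf]; split.
  apply: (@measurableT_comp _ _ _ (g_sigma_algebraType G')
    (g_sigma_algebraType G)) => //.
  apply: (@measurability _ _ (g_sigma_algebraType G') (g_sigma_algebraType G)
    setT u G) => //.
  by move=> _ [A GA <-]; rewrite setTI; exact: uG.
by case: bf => M [Mr bM]; exists M; split => // N MN x _; exact: bM.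
Qed.

Lemma bmeasD (R : realType) (T : pointedType) (G : set (set T)) (f g : T -> R) :
  bmeas G f -> bmeas G g -> bmeas G (f \+ g).
Proof.
move=> [mf bf] [mg bg]; split; first exact: measurable_realfun.measurable_funD.
exact: bounded_funD.
Qed.

Lemma bmeasN (R : realType) (T : pointedType) (G : set (set T)) (f : T -> R) :
  bmeas G f -> bmeas G (\- f).
Proof.
move=> [mf bf]; split; first exact: measurable_realfun.measurable_funN.
exact: bounded_funN.
Qed.

Lemma bmeas_cst (R : realType) (T : pointedType) (G : set (set T)) (c : R) :
  bmeas G (cst c).
Proof.
split; first exact: measurable_cst.
by exists `|c|; split => // M cM x _; exact: ltW.
Qed.

(** * Coordinate sigma-algebras on the path space *)

Lemma all_timeE (E : ptopologicalType) : all_time E = sigma_coord setT.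
Proof.
rewrite seteqP; split.
  apply: smallest_sub; first exact: smallest_sigma_algebra.
  move=> A [t _]; apply: sub_sigma_algebra2.
  by move=> B [s _ sB]; exists s.
apply: smallest_sub; first exact: smallest_sigma_algebra.
move=> A [t _ tA]; apply: sub_sigma_algebra; exists t => //.
by apply: sub_sigma_algebra; exists t => /=.
Qed.

(** Measurability of a path-valued map is tested one coordinate at a time, on open sets. It serves
    for [u] the identity, the shift, a delay of paths and the embedding of [E] as constant paths. *)
Lemma bmeas_sigma_coord_comp (R : realType) (E : ptopologicalType)
    (S : pointedType) (I : set nat) (G : set (set S)) (u : S -> nat -> E)
    (f : (nat -> E) -> R) :
  (forall s B, I s -> open B -> <<s G >> ((fun x => u x s) @^-1` B)) ->
  bmeas (sigma_coord I) f -> bmeas G (f \o u).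
Proof.
move=> uG; apply: bmeas_comp; apply: gen_sigma_preimage => A [s Is [B mB <-]].
rewrite setTI.
exact: (@gen_sigma_preimage _ _ open G (fun x => u x s) (uG s ^~ Is)).
Qed.

Lemma open_sigma_coord (E : ptopologicalType) (I : set nat) (s : nat)
    (B : set E) :
  I s -> open B -> <<s @sigma_coord E I >> (coord_process s @^-1` B).
Proof.
move=> Is oB; do 2 apply: sub_sigma_algebra; exists s => //.
by exists B; [exact: sub_sigma_algebra | rewrite setTI].
Qed.

Lemma bmeas_sigma_coordS (R : realType) (E : ptopologicalType) (I J : set nat) :
  I `<=` J -> @bmeas R _ (@sigma_coord E I) `<=` bmeas (sigma_coord J).
Proof.
move=> IJ f; apply: (@bmeas_sigma_coord_comp _ _ _ _ _ id) => s B /IJ Js.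
exact: open_sigma_coord.
Qed.

Lemma bmeas_coord_process (R : realType) (E : ptopologicalType) (f : E -> R)
    (I : set nat) (t : nat) :
  I t -> bmeas (@open E) f -> bmeas (sigma_coord I) (f \o coord_process t).
Proof.
by move=> It; apply: bmeas_comp => A; exact: open_sigma_coord.
Qed.

Lemma bmeas_time_shift (R : realType) (E : ptopologicalType) (t : nat)
    (Z : (nat -> E) -> R) :
  bmeas (all_time E) Z -> bmeas (future E t) (Z \o time_shift t).
Proof.
rewrite all_timeE; apply: bmeas_sigma_coord_comp => s B _.
by apply: open_sigma_coord; rewrite /= leq_addr.
Qed.

(** The sets that do not separate [w] from [w'] form a sigma-algebra containing the generators. The
    factorizations below thus follow by evaluating at a modified path, without approximation by
    simple functions. *)
Lemma bmeas_sigma_coord_eq (R : realType) (E : ptopologicalType) (I : set nat)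
    (f : (nat -> E) -> R) (w w' : nat -> E) :
  bmeas (sigma_coord I) f -> (forall s, I s -> w s = w' s) -> f w = f w'.
Proof.
move=> [mf _] ww'.
pose inv (A : set (nat -> E)) := A w <-> A w'.
have inv_coord : sigma_coord I `<=` inv.
  apply: smallest_sub.
    split=> [//|A|F invF]; rewrite /inv /setD /=; first tauto.
    by split=> -[k _ Fk]; exists k => //; apply/invF.
  by move=> A [s Is [B mB <-]]; rewrite /inv /preimage /= /coord_process ww'.
(* The level set of [f] through [w'] must also contain [w]. Since [bmeas] generates a sigma-algebra
   from [sigma_coord I] once more, [sigma_algebra_id] is needed. *)
have : <<s sigma_coord I >> (f @^-1` [set f w']).
  by rewrite -[f @^-1` _]setTI; exact: mf (measurable_set1 _).
rewrite sigma_algebra_id; last exact: smallest_sigma_algebra.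
by move=> fw; have [_] := inv_coord _ fw; exact.
Qed.

(** * The starting point of the chain *)

Lemma polish_open_setC1 (R : realType) (E : topologicalType) (x : E) :
  polish R E -> open (~` [set x]).
Proof.
move=> [_ [d [d0 dC dD dn _]]]; rewrite openE => y yx; apply/dn.
exists (d y x).
  rewrite lt0r; apply/andP; split; first by apply/eqP => /d0 /yx.
  (* Nonnegativity of [d] comes from the triangle inequality along [y], [x], [y], which reads 0 <= 2
     d(y, x). *)
  have := dD y x y; rewrite (dC x y) (iffRL (d0 y y)) // -mulr2n.
  by rewrite pmulrn_lge0.
by move=> z /= dyz zx; move: dyz; rewrite zx ltxx.
Qed.

(** Singletons are closed in a Polish space, so the event of starting at [x] is measurable and its
    complement is null. *)
Lemma ae_coord0 (R : realType) (E : ptopologicalType)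
    (P : borelType E -> pprobability (pathType E) R) (x : E) :
  polish R E -> homogeneous_markov_chain P ->
  {ae P x, forall w : nat -> E, coord_process 0 w = x}.
Proof.
move=> hE [P0 _].
pose A : set (pathType E) := coord_process 0 @^-1` [set x].
have mA : measurable A.
  rewrite -(setCK A); apply: measurableC.
  have := @open_sigma_coord _ setT 0 _ I (polish_open_setC1 x hE).
  by rewrite -all_timeE; exact.
apply/(negligibleP _ (measurableC mA)).
by have := probability_setC (P x) mA; rewrite P0 subee.
Qed.

(** * Shifts and factorization of random variables *)

Lemma time_shiftD (R : realType) (E : Type) (t : nat) (Z : (nat -> E) -> R)
    (h : E -> R) :
  (Z \+ (h \o coord_process 0)) \o time_shift t =
  (Z \o time_shift t) \+ (h \o coord_process t).
Proof. by apply/funext => w /=; rewrite /coord_process /time_shift addn0. Qed.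

Lemma bmeas_all_time_coord (R : realType) (E : ptopologicalType) (h : E -> R)
    (t : nat) :
  bmeas (@open E) h -> bmeas (all_time E) (h \o coord_process t).
Proof. by rewrite all_timeE; exact: bmeas_coord_process. Qed.

Lemma bmeas_all_time_shift (R : realType) (E : ptopologicalType) (t : nat)
    (Z : (nat -> E) -> R) :
  bmeas (all_time E) Z -> bmeas (all_time E) (Z \o time_shift t).
Proof.
move=> /(@bmeas_time_shift _ _ t) bZ.
by rewrite all_timeE; exact: bmeas_sigma_coordS bZ.
Qed.

Lemma future_factor (R : realType) (E : ptopologicalType) (t : nat)
    (Y : (nat -> E) -> R) : bmeas (future E t) Y ->
  exists2 Z, bmeas (all_time E) Z & Y = Z \o time_shift t.
Proof.
(* Delay the path by [t]: truncated subtraction holds it at [w 0] up to time [t]. Shifting before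
   delaying changes only times before [t], which [Y] does not see. *)
move=> bY; exists (Y \o (fun w s => w (s - t)%N)).
  apply: bmeas_sigma_coord_comp bY => s B _; rewrite all_timeE.
  exact: open_sigma_coord.
apply/funext => w /=; apply: (bmeas_sigma_coord_eq bY) => s /= ts.
by rewrite /time_shift subnKC.
Qed.

Lemma present_factor (R : realType) (E : ptopologicalType) (t : nat)
    (Y : (nat -> E) -> R) : bmeas (present E t) Y ->
  exists2 f, bmeas (@open E) f & Y = f \o coord_process t.
Proof.
(* [Y] depends only on the value at time [t], so it may be read off on constant paths. *)
move=> bY; exists (Y \o (fun x _ => x)).
  apply: bmeas_sigma_coord_comp bY => s B _ oB; exact: sub_sigma_algebra.
by apply/funext => w /=; apply: (bmeas_sigma_coord_eq bY) => s ->.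
Qed.

(** * Risk mappings along the chain *)

Section risk.
Context (R : realType) (E : ptopologicalType) (hE : polish R E).
Context (P : borelType E -> pprobability (pathType E) R).
Context (hX : homogeneous_markov_chain P).
Context (rho : forall x : E, dynamic_risk_mapping (P x)).

(* The library's filter instance is keyed on [pathType E], whereas the almost
   everywhere statements quantify over its carrier [nat -> E]. *)
#[local] Instance ae_path_filter (x : E) :
  @Filter (nat -> E) (nbhs (almost_everywhere (P x))).
Proof. exact: (@ae_filter_ringOfSetsType _ (pathType E) R (P x)). Qed.

(** Almost surely h(X_0) is the constant [h x], so monotonicity in both directions reduces the claim
    to translation by a constant. *)
Lemma risk0D (x : E) (Z : (nat -> E) -> R) (h : E -> R) :
  bmeas (all_time E) Z -> bmeas (@open E) h ->
  risk0 (rho x) (Z \+ (h \o coord_process 0)) = h x + risk0 (rho x) Z.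
Proof.
move=> bZ bh; have [_ transl mono] := risk0P (rho x).
have bZh : bmeas (all_time E) (Z \+ (h \o coord_process 0)).
  by apply: bmeasD => //; exact: bmeas_all_time_coord.
have bZc : bmeas (all_time E) (Z \+ cst (h x)).
  by apply: bmeasD => //; exact: bmeas_cst.
rewrite -transl //; apply/eqP; rewrite eq_le.
apply/andP; split; apply: mono => //;
  by apply: (filterS _ (ae_coord0 x hE hX)) => w /= ->.
Qed.

(** For positive times h(X_t) is F_t-measurable and conditional translation invariance applies; time
    0 allows only constant translations and goes through [risk0D]. *)
Lemma risk_atD (x : E) (t : nat) (Z : (nat -> E) -> R) (h : E -> R) :
  bmeas (all_time E) Z -> bmeas (@open E) h ->
  {ae P x, forall w, risk_at (rho x) t (Z \+ (h \o coord_process t)) w =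
                     h (coord_process t w) + risk_at (rho x) t Z w}.
Proof.
move=> bZ bh; case: t => [|t] /=.
  by apply: (filterS _ (ae_coord0 x hE hX)) => w /= ->; rewrite risk0D.
have [_ _ transl _] := riskSP (rho x) t; apply: transl => //.
by apply: bmeas_coord_process => /=.
Qed.

(** Write [Y] as a shifted [Z]; the Markov property then supplies [Y'] as the risk of [Z] started
    from X_t, and regularity makes it measurable. *)
Lemma markov_risk_future_present (x : E) (t : nat) (Y : (nat -> E) -> R) :
  markov_risk rho -> bmeas (future E t) Y ->
  exists2 Y' : (nat -> E) -> R, bmeas (present E t) Y' &
    {ae P x, forall w : nat -> E, risk_at (rho x) t Y w = Y' w}.
Proof.
move=> [reg mkv] /future_factor[Z bZ ->].
exists ((fun y => risk0 (rho y) Z) \o coord_process t); last exact: mkv.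
by apply: bmeas_coord_process => //; exact: reg.
Qed.

Lemma markov_risk_acceptance (x : E) (t : nat) (Z : (nat -> E) -> R) :
  markov_risk rho -> bmeas (all_time E) Z ->
  acceptance rho x t (Z \o time_shift t) <-> acceptance_tilde rho x t Z.
Proof.
move=> [_ mkv] bZ; have mkvZ := mkv x Z t bZ.
split=> -[_ le0]; split=> //; first by apply: (filterS2 _ _ mkvZ le0) => w ->.
  exact: bmeas_all_time_shift.
by apply: (filterS2 _ _ mkvZ le0) => w ->.
Qed.

Lemma acceptance_markov (x : E) (t : nat) (Z : (nat -> E) -> R) :
  regular (fun x : E => risk0 (rho x)) ->
  (forall Y : (nat -> E) -> R, bmeas (future E t) Y ->
     exists2 Y' : (nat -> E) -> R, bmeas (present E t) Y' &
       {ae P x, forall w : nat -> E, risk_at (rho x) t Y w = Y' w}) ->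
  (forall Z : (nat -> E) -> R, bmeas (all_time E) Z ->
     acceptance rho x t (Z \o time_shift t) <-> acceptance_tilde rho x t Z) ->
  bmeas (all_time E) Z ->
  {ae P x, forall w : nat -> E,
     risk_at (rho x) t (Z \o time_shift t) w = risk0 (rho (coord_process t w)) Z}.
Proof.
move=> reg fut acc bZ.
have [Y' /present_factor[f bf ->] riskf] := fut _ (bmeas_time_shift t bZ).
have bZt := bmeas_all_time_shift t bZ.
have bg := reg Z bZ; set g := (fun y => _) in bg.
have key h : bmeas (@open E) h ->
    {ae P x, forall w, f (coord_process t w) <= h (coord_process t w)} <->
    {ae P x, forall w, g (coord_process t w) <= h (coord_process t w)}.
  move=> bh; have bNh := bmeasN bh.
  have bZh : bmeas (all_time E) (Z \+ ((\- h) \o coord_process 0)).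
    by apply: bmeasD => //; exact: bmeas_all_time_coord.
  (* The shift turns h(X_0) into h(X_t), to which [risk_atD] applies. *)
  have := acc _ bZh; rewrite time_shiftD => -[to_tilde from_tilde].
  have riskD := risk_atD x t bZt bNh.
  split=> fgh.
  - have [|_] := to_tilde.
      split; first by apply: bmeasD => //; exact: bmeas_all_time_coord.
      apply: (filterS3 _ _ riskD riskf fgh) => w -> -> /=.
      by rewrite addrC subr_le0.
    (* [risk0D] is used at the starting point X_t(w); it holds for every starting point, so no
       further null set arises. *)
    by move=> le0; apply: (filterS _ le0) => w;
      rewrite risk0D //= addrC subr_le0.
  - have [|_ le0] := from_tilde.
      split=> //; apply: (filterS _ fgh) => w.
      by rewrite risk0D //= addrC subr_le0.
    apply: (filterS3 _ _ riskD riskf le0) => w -> -> /=.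
    by rewrite addrC subr_le0.
have fg : {ae P x, forall w, f (coord_process t w) <= g (coord_process t w)}.
  by apply/(key g bg); apply: aeW => w.
have gf : {ae P x, forall w, g (coord_process t w) <= f (coord_process t w)}.
  by apply/(key f bf); apply: aeW => w.
apply: (filterS3 _ _ riskf fg gf) => w -> /= le_fg le_gf.
by apply/eqP; rewrite eq_le le_fg.
Qed.

End risk.

Theorem lemma2p15 (R : realType) (E : ptopologicalType) (hE : polish R E)
  (P : borelType E -> pprobability (pathType E) R)
  (hP : measurable_fun [set: borelType E] P)
  (hX : homogeneous_markov_chain P)
  (rho : forall x : E, dynamic_risk_mapping (P x))
  (hreg : regular (fun x : E => risk0 (rho x))) :
  markov_risk rho <->
  (forall (x : E) (t : nat) (Y : (nat -> E) -> R),
     bmeas (future E t) Y ->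
     exists2 Y' : (nat -> E) -> R, bmeas (present E t) Y' &
       {ae P x, forall w : nat -> E, risk_at (rho x) t Y w = Y' w}) /\
  (forall (x : E) (t : nat) (Z : (nat -> E) -> R),
     bmeas (all_time E) Z ->
     (acceptance rho x t (Z \o time_shift t) <-> acceptance_tilde rho x t Z)).
Proof.
split=> [mkv|[fut acc]].
- split=> [x t Y|x t Z]; first exact: markov_risk_future_present.
  exact: markov_risk_acceptance.
- by split=> // x Z t; exact: acceptance_markov (fut x t) (acc x t).
Qed.
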